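(* Let $S\subset\{1,\dots,p\}$ and $\omega>0$. Suppose that $\mathbf F_{n,\theta_S^*}$ is nonsingular and $$\frac{\sqrt2\,\omega\,\zeta_{n,S}}{\sqrt{C_{\rm dev}\,\Delta_{{\rm mis},S}}}\le\frac12.$$ Then, for any $u\in\mathbb R^{|S|}$ with $\|u\|_2=1$, $$\mathbb P_0^{(n)}\Big(u^\top\xi_{n,S}>\sqrt{2C_{\rm dev}\Delta_{{\rm mis},S}\,\omega^2}\Big)\le e^{-\omega^2}.$$
   Context: $x_1,\dots,x_n\in\mathbb R^p$ are non-random. Model: $p_\theta(y\mid x)=\exp\{y\,x^\top\theta-b(x^\top\theta)+k(y)\}$ with $b,k$ known, $b$ strictly convex and three times differentiable; $C_{\rm dev}\ge1$ depends only on $b$ and satisfies $\sup_{|y|\le1/2}b''(x+y)\le C_{\rm dev}b''(x)$ for all $x\in\mathbb R$. $Y_1,\dots,Y_n$ are independent, $Y_i$ having density/mass function $p_{\theta_0}(\cdot\mid x_i)$ for a true $\theta_0\in\mathbb R^p\setminus\{0\}$, with joint law $\mathbb P_0^{(n)}$ and expectation $\mathbb E$; the moment generating function satisfies $\mathbb Ee^{tY_i}=\exp\{b(x_i^\top\theta_0+t)-b(x_i^\top\theta_0)\}$ for all $t\in\mathbb R$. For $S\subseteq\{1,\dots,p\}$: $x_{i,S}$ is the subvector of $x_i$ indexed by $S$; $L_{n,\theta_S}=\sum_i\{Y_ix_{i,S}^\top\theta_S-b(x_{i,S}^\top\theta_S)+k(Y_i)\}$ for $\theta_S\in\mathbb R^{|S|}$;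 $\theta_S^*=\arg\max_{\theta_S}\mathbb EL_{n,\theta_S}$; $\mathbf F_{n,\theta_S}=\sum_ib''(x_{i,S}^\top\theta_S)x_{i,S}x_{i,S}^\top$; $\mathbf V_{n,S}=\sum_ib''(x_i^\top\theta_0)x_{i,S}x_{i,S}^\top$; $\zeta_{n,S}=\max_i\|\mathbf F_{n,\theta_S^*}^{-1/2}x_{i,S}\|_2$; $\Delta_{{\rm mis},S}=\lambda_{\max}(\mathbf F_{n,\theta_S^*}^{-1/2}\mathbf V_{n,S}\mathbf F_{n,\theta_S^*}^{-1/2})$ (largest eigenvalue); normalized score $\xi_{n,S}=\mathbf F_{n,\theta_S^*}^{-1/2}\sum_{i=1}^n\{Y_i-b'(x_{i,S}^\top\theta_S^* )\}x_{i,S}$. *)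

(* Defs.v *)
From HB Require Import structures.
From mathcomp Require Import all_boot all_order all_algebra.
From mathcomp Require Import all_classical all_reals all_analysis.

Set Implicit Arguments.
Unset Strict Implicit.
Unset Printing Implicit Defensive.

Import Order.TTheory GRing.Theory Num.Theory.
Import numFieldNormedType.Exports.

Local Open Scope classical_set_scope.
Local Open Scope ring_scope.

Section Linear.
Context {R : realType}.

Definition dotv m (u v : 'cV[R]_m) : R := (u^T *m v) 0 0.

(* The norm `|v| of the library on matrices is the sup norm. *)
Definition norm2 m (v : 'cV[R]_m) : R := Num.sqrt (dotv v v).

Definition subvec p (S : {set 'I_p}) (v : 'cV[R]_p) : 'cV[R]_#|S| :=
  rowsub (@enum_val _ (mem S)) v.

Definition psdmx m (A : 'M[R]_m) : Prop :=
  A^T = A /\ forall v : 'cV[R]_m, 0 <= dotv v (A *m v).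

(* The positive semidefinite square root of a positive semidefinite matrix;
   it exists and is unique, and the default 0 is for other matrices. *)
Definition sqrtmx m (A : 'M[R]_m) : 'M[R]_m :=
  xget 0 [set B | psdmx B /\ B *m B = A].

Definition invsqrtmx m (A : 'M[R]_m) : 'M[R]_m := invmx (sqrtmx A).

Definition lambda_max m (A : 'M[R]_m) : R := sup [set a : R | eigenvalue A a].

Definition strictly_convex (b : R -> R) : Prop :=
  forall x y t : R, x != y -> 0 < t < 1 ->
    b (t * x + (1 - t) * y) < t * b x + (1 - t) * b y.

Definition three_times_derivable (b : R -> R) : Prop :=
  forall j : nat, (j < 3)%N -> forall x : R, derivable (derive1n j b) x 1.

(* The maximum must be finite: among other things this makes E(L) at the
   maximizer a genuine integral and not the default value of an undefined one. *)
Definition is_argmax (A : Type) (f : A -> \bar R) (a : A) : Prop :=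
  f a \is a fin_num /\ forall a' : A, (f a' <= f a)%E.

End Linear.

Definition mutually_independent (d : measure_display) (T : measurableType d)
    (R : realType) (P : probability T R) n (Y : 'I_n -> {RV P >-> R}) : Prop :=
  forall (J : {set 'I_n}) (A : 'I_n -> set R), (forall i, measurable (A i)) ->
    P [set w | forall i, i \in J -> A i (Y i w)] =
    (\prod_(i in J) P (Y i @^-1` A i))%E.

Section GLM.
Context {R : realType} (b k : R -> R).

Definition glm_density p (theta x : 'cV[R]_p) (y : R) : R :=
  expR (y * dotv x theta - b (dotv x theta) + k y).

(* nu is the reference measure: the Lebesgue measure on the support for
   densities, the counting measure on the countable support for mass functions. *)
Definition glm_model
    (nu : {sigma_finite_measure set (measurableTypeR R) -> \bar R}) p : Prop :=
  measurable_fun setT k /\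
  forall theta x : 'cV[R]_p, (\int[nu]_y (glm_density theta x y)%:E = 1)%E.

Definition has_density
    (nu : {sigma_finite_measure set (measurableTypeR R) -> \bar R})
    (d : measure_display) (T : measurableType d) (P : probability T R)
    (X : {RV P >-> R}) (f : R -> R) : Prop :=
  forall A : set R, measurable A ->
    distribution P X A = (\int[nu]_(y in A) (f y)%:E)%E.

Context n p (x : 'I_n -> 'cV[R]_p) (S : {set 'I_p}).

Definition loglik (y : 'I_n -> R) (thetaS : 'cV[R]_#|S|) : R :=
  \sum_(i < n) (y i * dotv (subvec S (x i)) thetaS
                - b (dotv (subvec S (x i)) thetaS) + k (y i)).

Definition fisher (thetaS : 'cV[R]_#|S|) : 'M[R]_#|S| :=
  \sum_(i < n) derive1n 2 b (dotv (subvec S (x i)) thetaS) *: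
    (subvec S (x i) *m (subvec S (x i))^T).

Definition score_variance (theta0 : 'cV[R]_p) : 'M[R]_#|S| :=
  \sum_(i < n) derive1n 2 b (dotv (x i) theta0) *:
    (subvec S (x i) *m (subvec S (x i))^T).

Definition zeta (thetaS : 'cV[R]_#|S|) : R :=
  \big[Num.max/0]_(i < n) norm2 (invsqrtmx (fisher thetaS) *m subvec S (x i)).

Definition Delta_mis (theta0 : 'cV[R]_p) (thetaS : 'cV[R]_#|S|) : R :=
  lambda_max (invsqrtmx (fisher thetaS) *m score_variance theta0
              *m invsqrtmx (fisher thetaS)).

Definition normalized_score (y : 'I_n -> R) (thetaS : 'cV[R]_#|S|) :
    'cV[R]_#|S| :=
  invsqrtmx (fisher thetaS) *m
  \sum_(i < n) (y i - derive1 b (dotv (subvec S (x i)) thetaS)) *: subvec S (x i).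

End GLM.

(* Main.v *)
Require Import Defs.
From HB Require Import structures.
From mathcomp Require Import all_boot all_order all_algebra.
From mathcomp Require Import all_classical all_reals all_analysis.
From mathcomp Require Import measurable_realfun ring lra.

Set Implicit Arguments.
Unset Strict Implicit.
Unset Printing Implicit Defensive.

Import Order.TTheory GRing.Theory Num.Theory.
Import numFieldNormedType.Exports.

Local Open Scope classical_set_scope.
Local Open Scope ring_scope.

(** Put [v = A u], where [A] is the inverse square root of the Fisher
information, and [a_i = x_{i,S} . v]. Since [A] is symmetric,
[u . xi = sum_i a_i (Y_i - b'(x_{i,S} . thetaS))].

The centring may be changed to the true means [mu_i = b'(x_i . theta0)]: the
expected log-likelihood is maximal at [thetaS], so its derivative there in the
direction [v] vanishes, which says [sum_i a_i (mu_i - b'(x_{i,S} . thetaS)) = 0]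
([score_equation]). That [mu_i] is the mean of [Y_i] is read off the moment
generating function ([mean_of_mgf]).

So [u . xi] is a weighted sum of centred independent variables, and Chernoff's
bound applies ([independent_chernoff]). With [eta_i = x_i . theta0], the
logarithm of the moment generating function of [a_i (Y_i - mu_i)] at [r] is
[b(eta_i + r a_i) - b(eta_i) - r a_i mu_i], a second-order Taylor remainder; as
long as [|r a_i| <= 1/2] it is at most [C_dev b''(eta_i) (r a_i)^2 / 2]
([cumulant_quadratic_le]). Two facts of linear algebra control the weights:
[|a_i| <= zeta] by Cauchy-Schwarz ([score_weight_le_zeta]), and
[sum_i b''(eta_i) a_i^2 = u . A V A u <= Delta] because a Rayleigh quotient is
at most the largest eigenvalue ([rayleigh_le_lambda_max], [Delta_mis_ge]). The
total exponent is then at most [C_dev Delta r^2 / 2 - r s], and the choice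
[r = sqrt 2 omega / sqrt (C_dev Delta)], for which the smallness hypothesis is
exactly [r zeta <= 1/2], turns it into [omega^2 - 2 omega^2].

This [r] is defined only for [Delta > 0]. When [Delta = 0], positivity of [b'']
([derive2_cumulant_gt0]) forces all the [a_i] to vanish, and the event is
empty. *)

(** * Real analysis *)

(** The mean value theorem for an increment of either sign: the intermediate
point is [x + r] with [r] between [0] and [s], encoded by [|r| <= |s|] and
[0 <= r * s]. *)
Lemma MVT_increment (R : realType) (f df : R -> R) (x s : R) :
  (forall y : R, is_derive y 1 f (df y)) ->
  exists r, [/\ `|r| <= `|s|, 0 <= r * s & f (x + s) - f x = df (x + r) * s].
Proof.
move=> fdf.
have fcont (A : set R) : {within A, continuous f}.
  apply: continuous_subspaceT => y.
  by apply: differentiable_continuous; apply/derivable1_diffP; case: (fdf y).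
have [s0|s0] := leP 0 s.
- have xs : x <= x + s by rewrite lerDl.
  have [c] := MVT_segment xs (fun y _ => fdf y) (fcont _).
  rewrite in_itv /= => /andP[xc cx] fE.
  have r0 : 0 <= c - x by rewrite subr_ge0.
  exists (c - x); split.
  + by rewrite !ger0_norm// lerBlDl.
  + exact: mulr_ge0.
  + by rewrite fE subrKC; congr (_ * _); rewrite addrAC subrr add0r.
- have xs : x + s <= x by rewrite gerDl ltW.
  have [c] := MVT_segment xs (fun y _ => fdf y) (fcont _).
  rewrite in_itv /= => /andP[xc cx] fE.
  have r0 : c - x <= 0 by rewrite subr_le0.
  exists (c - x); split.
  + rewrite ler0_norm// ltr0_norm// lerN2; lra.
  + by rewrite mulr_le0// ltW.
  + by rewrite subrKC -opprB fE -mulrN; congr (_ * _); lra.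
Qed.

(** Subtract from [f] its tangent at [z] and the parabola of curvature [K]: two
applications of the mean value theorem write the increment of what is left as
[(ddf (z + q) - K) * (r * s)] with [r * s >= 0] and [|q| <= |r| <= |s|]. *)
Lemma taylor2_le (R : realType) (f df ddf : R -> R) (z h K s : R) :
  (forall y : R, is_derive y 1 f (df y)) ->
  (forall y : R, is_derive y 1 df (ddf y)) ->
  (forall y, `|y| <= h -> ddf (z + y) <= K) ->
  `|s| <= h -> f (z + s) - f z - s * df z <= K * s ^+ 2 / 2.
Proof.
move=> fdf dfddf ddfK sh.
pose g (y : R) : R := f y - y * df z - K / 2 * (y - z) ^+ 2.
have gdg (y : R) : is_derive y 1 g (df y - df z - K * (y - z)).
  have fy := fdf y.
  rewrite /g; apply: is_derive_eq.
  by rewrite /GRing.scale /=; field.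
have [r [rs rs0 gE]] := MVT_increment z s gdg.
have [q [qr _ dfE]] := MVT_increment z r dfddf.
have -> : f (z + s) - f z - s * df z = (g (z + s) - g z) + K * s ^+ 2 / 2.
  by rewrite /g; field.
rewrite gE -lerBrDr subrr dfE.
have -> : (ddf (z + q) * r - K * (z + r - z)) * s = (ddf (z + q) - K) * (r * s).
  by ring.
by rewrite mulr_le0_ge0// subr_le0 ddfK// (le_trans qr)// (le_trans rs).
Qed.

Lemma derive_at_global_min (R : realType) (f : R -> R) (c df : R) :
  (forall t : R, derivable f t 1) -> is_derive c 1 f df ->
  (forall t, f c <= f t) -> df = 0.
Proof.
move=> fder fc cmin.
have cab : c \in `]c - 1, c + 1[%R by rewrite in_itv /=; lra.
have := @derive1_at_min R f (c - 1) (c + 1) c ltac:(lra) (fun t _ => fder t) cab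
  (fun t _ => cmin t).
by move=> /@derive_val fc0; rewrite -fc0 derive_val.
Qed.

(** * Quadratic forms and the largest eigenvalue *)

Lemma dotvE (R : realType) m (u v : 'cV[R]_m) :
  dotv u v = \sum_i u i 0 * v i 0.
Proof. by rewrite /dotv mxE; apply: eq_bigr => i _; rewrite mxE. Qed.

Lemma dotvC (R : realType) m (u v : 'cV[R]_m) : dotv u v = dotv v u.
Proof. by rewrite !dotvE; apply: eq_bigr => i _; rewrite mulrC. Qed.

Lemma dotvDr (R : realType) m (u v w : 'cV[R]_m) :
  dotv u (v + w) = dotv u v + dotv u w.
Proof. by rewrite /dotv mulmxDr mxE. Qed.

Lemma dotvZr (R : realType) m (u v : 'cV[R]_m) a :
  dotv u (a *: v) = a * dotv u v.
Proof. by rewrite /dotv -scalemxAr mxE. Qed.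

Lemma dotvDl (R : realType) m (u v w : 'cV[R]_m) :
  dotv (v + w) u = dotv v u + dotv w u.
Proof. by rewrite dotvC dotvDr !(dotvC u). Qed.

Lemma dotvZl (R : realType) m (u v : 'cV[R]_m) a :
  dotv (a *: u) v = a * dotv u v.
Proof. by rewrite dotvC dotvZr (dotvC u). Qed.

Lemma dotv_sumr (R : realType) m (u : 'cV[R]_m) I (r : seq I)
  (v : I -> 'cV[R]_m) :
  dotv u (\sum_(i <- r) v i) = \sum_(i <- r) dotv u (v i).
Proof. by rewrite /dotv mulmx_sumr summxE. Qed.

Lemma dotv_mulmxl (R : realType) m (M : 'M[R]_m) (u v : 'cV[R]_m) :
  dotv (M *m u) v = dotv u (M^T *m v).
Proof. by rewrite /dotv trmx_mul mulmxA. Qed.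

Lemma dotv_ge0 (R : realType) m (u : 'cV[R]_m) : 0 <= dotv u u.
Proof. by rewrite dotvE sumr_ge0// => i _; rewrite -expr2 sqr_ge0. Qed.

Lemma dotv_eq0 (R : realType) m (u : 'cV[R]_m) : dotv u u = 0 -> u = 0.
Proof.
rewrite dotvE => /eqP; rewrite psumr_eq0; last first.
  by move=> i _; rewrite -expr2 sqr_ge0.
move=> /allP u0; apply/colP => i; rewrite mxE.
by have := u0 i (mem_index_enum i); rewrite /= -expr2 sqrf_eq0 => /eqP.
Qed.

Lemma norm2_sqr (R : realType) m (u : 'cV[R]_m) : norm2 u ^+ 2 = dotv u u.
Proof. by rewrite sqr_sqrtr// dotv_ge0. Qed.

Lemma dotv_cauchy_schwarz (R : realType) m (u v : 'cV[R]_m) :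
  norm2 u = 1 -> `|dotv u v| <= norm2 v.
Proof.
move=> u1; have {}u1 : dotv u u = 1 by rewrite -norm2_sqr u1 expr1n.
rewrite -(@ler_pXn2r _ 2)// ?nnegrE ?sqrtr_ge0// norm2_sqr.
rewrite -normrX ger0_norm ?sqr_ge0// -subr_ge0.
have := dotv_ge0 (v + (- dotv u v) *: u).
rewrite !dotvDl !dotvDr !dotvZl !dotvZr u1 (dotvC v u).
by move=> /le_trans; apply; rewrite le_eqVlt; apply/orP; left; apply/eqP; ring.
Qed.

(** The semidefinite form is nonnegative along the line [u + t *: (M *m u)],
where it equals [2 t |M u|^2 + O(t^2)]; a small negative [t] forces
[M *m u = 0]. *)
Lemma psd_isotropic_ker (R : realType) m (M : 'M[R]_m) (u : 'cV[R]_m) :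
  psdmx M -> dotv u (M *m u) = 0 -> M *m u = 0.
Proof.
move=> [Msym Mpos] u0; set r := M *m u.
set N := dotv r r; set q := dotv r (M *m r).
have q0 : 0 <= q by exact: Mpos.
suff : N ^+ 2 <= 0.
  by move=> N0; apply: dotv_eq0; apply/eqP; rewrite -sqrf_eq0 eq_le N0 sqr_ge0.
(* [t = - N * s] makes the linear term dominate: [q * s < 1]. *)
pose s := (q + 1)^-1.
have s0 : 0 < s by rewrite invr_gt0 ltr_wpDl.
have uMr : dotv u (M *m r) = N by rewrite -{1}Msym -dotv_mulmxl.
have := Mpos (u + (- N * s) *: r).
rewrite mulmxDr -scalemxAr !dotvDl !dotvDr !dotvZl !dotvZr u0 uMr -/r -/N -/q.
have qs : q * s = 1 - s by rewrite /s; field; rewrite gt_eqF// ltr_wpDl.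
have -> : 0 + - N * s * N + (- N * s * N + - N * s * (- N * s * q)) =
    - (N ^+ 2 * (s * (1 + s))).
  have -> : - N * s * (- N * s * q) = N ^+ 2 * s * (q * s) by ring.
  by rewrite qs; ring.
by rewrite oppr_ge0 pmulr_lle0// mulr_gt0// addr_gt0.
Qed.

Lemma continuous_dotv_row (R : realType) m (f g : 'rV[R]_m -> 'cV[R]_m) :
  (forall i, continuous (fun w => f w i 0)) ->
  (forall i, continuous (fun w => g w i 0)) ->
  continuous (fun w => dotv (f w) (g w)).
Proof.
move=> fc gc; rewrite (_ : (fun w => _) = fun w => \sum_i f w i 0 * g w i 0).
  apply: continuous_big => [|i _ w]; first exact: add_continuous.
  exact: (cvgM (fc i w) (gc i w)).
by apply/funext => w; rewrite dotvE.
Qed.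

Lemma coordT_continuous (R : realType) m i :
  continuous (fun w : 'rV[R]_m => w^T i 0).
Proof.
rewrite (_ : (fun w => _) = fun w : 'rV[R]_m => w 0 i).
  exact: coord_continuous.
by apply/funext => w; rewrite mxE.
Qed.

Lemma sphere_compact (R : realType) m :
  compact [set w : 'rV[R]_m | dotv w^T w^T = 1].
Proof.
apply: bounded_closed_compact; last first.
  apply: (@closed_comp _ _ (fun w : 'rV[R]_m => dotv w^T w^T) [set 1]).
    move=> w _; apply: continuous_dotv_row => i; exact: coordT_continuous.
  exact: closed_eq.
exists 1; split => // M M1 w /= w1.
apply: le_trans (ltW M1).
rewrite [leLHS]/Num.norm /= mx_normrE; apply: bigmax_le => // -[i j] _ /=.
rewrite -(@ler_pXn2r _ 2)// ?nnegrE// expr1n -normrX ger0_norm ?sqr_ge0//.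
rewrite -w1 dotvE (bigD1 j)//= !mxE ord1 -expr2 lerDl.
by apply: sumr_ge0 => k _; rewrite -expr2 sqr_ge0.
Qed.

(** The quadratic form attains its maximum [l] on the unit sphere, at some [c].
Then [l%:M - M] is positive semidefinite and vanishes at [c], so [c] is an
eigenvector for [l]; and every eigenvalue is the value of the form at a
normalized eigenvector, so [l] is the largest one. *)
Lemma rayleigh_le_lambda_max (R : realType) m (M : 'M[R]_m) (u : 'cV[R]_m) :
  M^T = M -> norm2 u = 1 -> dotv u (M *m u) <= lambda_max M.
Proof.
move=> Msym u1; have {}u1 : dotv u u = 1 by rewrite -norm2_sqr u1 expr1n.
pose q (w : 'rV[R]_m) := dotv w^T (M *m w^T).
have sphere0 : [set w : 'rV[R]_m | dotv w^T w^T = 1] !=set0.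
  by exists u^T; rewrite /= trmxK.
have qcont : continuous q.
  apply: continuous_dotv_row => i; first exact: coordT_continuous.
  rewrite (_ : (fun w => _) = fun w : 'rV[R]_m => \sum_j M i j * w^T j 0).
    apply: continuous_big => [|j _ w]; first exact: add_continuous.
    apply: continuousM; [exact: cst_continuous|exact: coordT_continuous].
  by apply/funext => w; rewrite mxE.
have [c] := EVT_max_rV sphere0 (@sphere_compact R m)
  (continuous_subspaceT qcont).
rewrite inE /= => c1 cmax; set l := q c in cmax.
have qle w : q w <= l * dotv w^T w^T.
  have [w0|w0] := eqVneq (dotv w^T w^T) 0.
    rewrite w0 mulr0 /q (dotv_eq0 w0) mulmx0.
    by rewrite -[X in dotv _ X](scale0r 0) dotvZr mul0r.
  have wpos : 0 < dotv w^T w^T by rewrite lt_def w0 dotv_ge0.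
  have n0 : 0 < norm2 w^T by rewrite sqrtr_gt0.
  have := cmax ((norm2 w^T)^-1 *: w).
  rewrite inE /= /q linearZ /= -scalemxAr !dotvZl !dotvZr -norm2_sqr.
  have -> : (norm2 w^T)^-1 * ((norm2 w^T)^-1 * norm2 w^T ^+ 2) = 1.
    by field; rewrite gt_eqF.
  by move=> /(_ erefl); rewrite mulrA -invfM -expr2 mulrC ler_pdivrMr ?exprn_gt0.
have psdlM : psdmx (l%:M - M).
  split; first by rewrite linearB /= tr_scalar_mx Msym.
  move=> v; rewrite mulmxBl mul_scalar_mx -scaleN1r dotvDr !dotvZr mulN1r subr_ge0.
  by have := qle v^T; rewrite /q trmxK.
have lc : (l%:M - M) *m c^T = 0.
  apply: psd_isotropic_ker => //.
  by rewrite mulmxBl mul_scalar_mx -scaleN1r dotvDr !dotvZr c1 mulN1r mulr1 subrr.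
have eigl : eigenvalue M l.
  apply/eigenvalueP; exists c; last first.
    apply/eqP => c0; move: c1; rewrite c0 trmx0.
    rewrite -[X in dotv _ X](scale0r 0) dotvZr mul0r.
    by move/eqP; rewrite eq_sym oner_eq0.
  move/(congr1 trmx): lc; rewrite trmx_mul trmxK linearB /= tr_scalar_mx Msym.
  by rewrite mulmxBr mul_mx_scalar trmx0 => /eqP; rewrite subr_eq0 => /eqP.
have eigle a : eigenvalue M a -> a <= l.
  move=> /eigenvalueP[v vM v0].
  have Mv : M *m v^T = a *: v^T by rewrite -{1}Msym -trmx_mul vM linearZ.
  have vpos : 0 < dotv v^T v^T.
    rewrite lt_def dotv_ge0 andbT; apply: contra v0 => /eqP /dotv_eq0 v0.
    by rewrite -[v]trmxK v0 trmx0.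
  by have := qle v; rewrite /q Mv dotvZr ler_pM2r.
apply: (@le_trans _ _ l).
  by have := qle u^T; rewrite /q trmxK u1 mulr1.
apply: sup_upper_bound => //; split; first by exists l.
by exists l => a; exact: eigle.
Qed.

(** * Expectation of a product of independent variables *)

Section weighted_integral.
Import HBNNSimple.

Lemma integral_weight_nnsfun d d' (T : measurableType d)
  (T' : measurableType d') (R : realType) (mu : {measure set T -> \bar R})
  (W : T -> R) (Y : T -> T') (h : {nnsfun T' >-> R}) :
  measurable_fun setT W -> (forall w, 0 <= W w) -> measurable_fun setT Y ->
  (\int[mu]_w (W w * h (Y w))%:E =
   \sum_(k \in range h)
     k%:E * \int[mu]_w (W w * \1_(h @^-1` [set k]) (Y w))%:E)%E.
Proof.
move=> mW W0 mY.
have m1 k : measurable_fun [set: T]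
    (EFin \o (fun w => W w * \1_(h @^-1` [set k]) (Y w))).
  apply/measurable_EFinP; apply: measurable_funM => //.
  have mi : measurable_fun [set: T'] (\1_(h @^-1` [set k]) : T' -> R).
    exact: measurable_indic.
  exact: (measurableT_comp mi mY).
have ge1 k w : (0 <= (W w * \1_(h @^-1` [set k]) (Y w))%:E)%E.
  by rewrite lee_fin mulr_ge0.
transitivity (\int[mu]_w (\sum_(k \in range h)
    k%:E * (W w * \1_(h @^-1` [set k]) (Y w))%:E))%E.
  apply: eq_integral => w _.
  rewrite EFinM fimfunE -fsumEFin//.
  rewrite ge0_mule_fsumr => [|k]; last exact: nnfun_muleindic_ge0.
  by apply: eq_fsbigr => k _; rewrite -!EFinM mulrCA.
rewrite ge0_integral_fsum//.
- apply: eq_fsbigr => k; rewrite inE => -[y _ <-].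
  by apply: ge0_integralZl => //; [exact: m1|rewrite lee_fin].
- by move=> k; apply: measurable_funeM; exact: m1.
- move=> k w _.
  rewrite -EFinM mulrCA EFinM mule_ge0 ?lee_fin//.
  by rewrite -lee_fin EFinM; exact: nnfun_muleindic_ge0.
Qed.

(** If the weight [W] is uncorrelated with every event [Y \in A], it is
uncorrelated with every nonnegative function of [Y]: the property passes to
simple functions by linearity and to their increasing limits by monotone
convergence. For a probability measure, [c] is the integral of [W]. *)
Lemma ge0_integral_weight_comp d d' (T : measurableType d)
  (T' : measurableType d') (R : realType) (mu : {measure set T -> \bar R})
  (W : T -> R) (Y : T -> T') (c : R) (f : T' -> R) :
  measurable_fun setT W -> (forall w, 0 <= W w) -> measurable_fun setT Y ->
  (forall A, measurable A ->
    \int[mu]_w (W w * \1_A (Y w))%:E = c%:E * mu (Y @^-1` A))%E ->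
  measurable_fun setT f -> (forall y, 0 <= f y) ->
  (\int[mu]_w (W w * f (Y w))%:E = c%:E * \int[mu]_w (f (Y w))%:E)%E.
Proof.
move=> mW W0 mY WE mf f0.
have mEf : measurable_fun setT (EFin \o f) by exact/measurable_EFinP.
pose f_ := nnsfun_approx measurableT mEf.
have f_f y : (f_ n y)%:E @[n --> \oo] --> (f y)%:E.
  by apply: (@cvg_nnsfun_approx _ _ _ setT measurableT _ mEf) => // z _; rewrite lee_fin.
have f_nd y m n : (m <= n)%N -> (f_ m y <= f_ n y)%R.
  by move=> mn; exact/lefP/nd_nnsfun_approx.
have cvgW (V : T -> R) : measurable_fun setT V -> (forall w, 0 <= V w) ->
    (\int[mu]_w (V w * f_ n (Y w))%:E @[n --> \oo] -->
     \int[mu]_w (V w * f (Y w))%:E)%E.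
  move=> mV V0.
  rewrite [X in _ --> X](_ : _ =
      \int[mu]_w (limn (fun n => (V w * f_ n (Y w))%:E)))%E.
    apply: (@cvg_monotone_convergence _ _ _ mu setT measurableT
      (fun n w => (V w * f_ n (Y w))%:E)) => //.
    + move=> n; apply/measurable_EFinP; apply: measurable_funM => //.
      have mfn : measurable_fun [set: T'] (f_ n : T' -> R) by [].
      exact: (measurableT_comp mfn mY).
    + by move=> n w _; rewrite lee_fin mulr_ge0.
    + by move=> w _ m n mn; rewrite lee_fin ler_wpM2l// f_nd.
  apply: eq_integral => w _; apply/esym/cvg_lim => //.
  have : ((V w)%:E * (f_ n (Y w))%:E)%E @[n --> \oo] -->
      ((V w)%:E * (f (Y w))%:E)%E by apply: cvgeZl => //; exact: f_f.
  by [].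
have step n : (\int[mu]_w (W w * f_ n (Y w))%:E =
    c%:E * \int[mu]_w (1 * f_ n (Y w))%:E)%E.
  rewrite !integral_weight_nnsfun//.
  have mpre k : measurable (Y @^-1` (f_ n @^-1` [set k])).
    by rewrite -[X in measurable X]setTI; apply: mY.
  have int1 k : (\int[mu]_w (1 * \1_(f_ n @^-1` [set k]) (Y w))%:E =
      mu (Y @^-1` (f_ n @^-1` [set k])))%E.
    under eq_integral do rewrite mul1r.
    transitivity (\int[mu]_w (\1_(Y @^-1` (f_ n @^-1` [set k])) w)%:E)%E => //.
    by rewrite integral_indic// setIT.
  rewrite ge0_mule_fsumr => [|k].
    by apply: eq_fsbigr => k _; rewrite WE// int1 muleCA.
  rewrite int1; apply: (@mulemu_ge0 _ _ _ mu k
    (fun k => Y @^-1` (f_ n @^-1` [set k]))) => k0.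
  by rewrite preimage_nnfun0.
have := cvgW _ mW W0.
under eq_cvg do rewrite step.
move=> cW.
have c1 : (c%:E * \int[mu]_w (1 * f_ n (Y w))%:E @[n --> \oo] -->
  c%:E * \int[mu]_w (f (Y w))%:E)%E.
  apply: cvgeZl => //.
  under [X in _ --> X]eq_integral do rewrite -(mul1r (f _)).
  exact: (cvgW (fun=> 1)).
exact: (cvg_unique _ cW c1).
Qed.

End weighted_integral.

(** Independence is given by the product rule on events. The events are
traded for functions one coordinate at a time: in the induction, the [g i] with
[i >= k] are still indicators, and [ge0_integral_weight_comp] lifts coordinate
[k] from indicators to an arbitrary function, the product over the other
coordinates being the weight. *)
Lemma independent_integral_prod (d : measure_display) (T : measurableType d)
  (R : realType) (P : probability T R) n (Y : 'I_n -> {RV P >-> R})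
  (g : 'I_n -> R -> R) (m : 'I_n -> R) :
  mutually_independent Y ->
  (forall i, measurable_fun [set: R] (g i)) -> (forall i y, 0 <= g i y) ->
  (forall i, \int[P]_w (g i (Y i w))%:E = (m i)%:E)%E ->
  (\int[P]_w (\prod_i g i (Y i w))%:E = (\prod_i m i)%:E)%E.
Proof.
move=> Yind.
suff step k : forall (g : 'I_n -> R -> R) (m : 'I_n -> R),
    (forall i, measurable_fun [set: R] (g i)) -> (forall i y, 0 <= g i y) ->
    (forall i, \int[P]_w (g i (Y i w))%:E = (m i)%:E)%E ->
    (forall i : 'I_n, (k <= i)%N ->
      exists2 A : set R, measurable A & g i = \1_A) ->
    (\int[P]_w (\prod_i g i (Y i w))%:E = (\prod_i m i)%:E)%E.
  move=> mg g0 gm; apply: (step n) => // i.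
  by rewrite leqNgt ltn_ord.
elim: k => [|k IH] {}g {}m mg g0 gm gind.
  have [A AE] : {A : 'I_n -> set R &
      forall i, measurable (A i) /\ g i = \1_(A i)}.
    apply: (choice (P := fun i (B : set R) => measurable B /\ g i = \1_B)) => i.
    by have [A mA gA] := gind i (leq0n _); exists A.
  have mYA i : measurable (Y i @^-1` A i).
    by apply: measurable_funPTI; case: (AE i).
  have PYA i : P (Y i @^-1` A i) = (m i)%:E.
    rewrite -gm (AE i).2.
    transitivity (\int[P]_w (\1_(Y i @^-1` A i) w)%:E)%E => //.
    by rewrite integral_indic// setIT.
  have allE : [set w | forall i, i \in [set: 'I_n]%SET -> A i (Y i w)] =
      \bigcap_(i in [set: 'I_n]) (Y i @^-1` A i).
    apply/seteqP; split=> w /= wA i; first by move=> _; apply: wA; rewrite inE.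
    by move=> _; exact: wA.
  transitivity (\int[P]_w
    (\1_[set w | forall i, i \in [set: 'I_n]%SET -> A i (Y i w)] w)%:E)%E.
    apply: eq_integral => w _; congr EFin.
    rewrite indicE; case: (boolP (w \in _)); rewrite ?inE ?notin_setE /= => wA.
      apply: big1 => i _; rewrite (AE i).2 indicE mem_set//.
      by apply: wA; rewrite inE.
    have [i /not_implyP[_ iA]] := (existsNP _).2 wA.
    rewrite (bigD1 i)//= (AE i).2 indicE memNset// mul0r//.
  rewrite integral_indic//; last first.
    by rewrite allE; apply: fin_bigcap_measurable => // i _.
  rewrite setIT; apply: (etrans (Yind [set: 'I_n]%SET A (fun i => (AE i).1))).
  rewrite (eq_bigr (fun i => (m i)%:E)) => [|i _]; last exact: PYA.
  by rewrite prodEFin; congr EFin; apply: eq_bigl => i; rewrite finset.in_setT.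
have [kn|nk] := ltnP k n; last first.
  apply: IH => // i ki; exfalso.
  by move: (leq_ltn_trans (leq_trans nk ki) (ltn_ord i)); rewrite ltnn.
pose i0 := Ordinal kn.
pose W w := \prod_(j | j != i0) g j (Y j w).
pose c := \prod_(j | j != i0) m j.
transitivity (\int[P]_w (W w * g i0 (Y i0 w))%:E)%E.
  by apply: eq_integral => w _; rewrite (bigD1 i0)//= mulrC.
rewrite (@ge0_integral_weight_comp _ _ _ _ _ P W (Y i0) c (g i0))//.
- by rewrite gm -EFinM (bigD1 i0)//= mulrC.
- rewrite (_ : W = fun w => \prod_j if j != i0 then g j (Y j w) else 1).
    apply: measurable_prod => j _; case: (j != i0); last exact: measurable_cst.
    exact: (measurableT_comp (mg j)).
  by apply/funext => w; rewrite /W big_mkcond.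
- by move=> w; apply: prodr_ge0 => j _.
- move=> A mA.
  pose g' j := if j == i0 then \1_A : R -> R else g j.
  pose m' j := if j == i0 then fine (P (Y i0 @^-1` A)) else m j.
  have mYA : measurable (Y i0 @^-1` A) by exact: measurable_funPTI.
  have m'E : (\prod_j m' j)%:E = (c%:E * P (Y i0 @^-1` A))%E.
    rewrite (bigD1 i0)//= {1}/m' eqxx mulrC EFinM fineK ?fin_num_measure//.
    by congr (_%:E * _)%E; apply: eq_bigr => j /negPf; rewrite /m' => ->.
  rewrite -m'E -(IH g' m').
  + apply: eq_integral => w _; rewrite [in RHS](bigD1 i0)//= {1}/g' eqxx mulrC.
    by congr ((_ * _)%:E); apply: eq_bigr => j /negPf; rewrite /g' => ->.
  + move=> j; rewrite /g'; case: ifP => // _; exact: measurable_indic.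
  + by move=> j y; rewrite /g'; case: ifP.
  + move=> j; rewrite /g' /m'; case: eqP => [->|_]; last exact: gm.
    rewrite fineK ?fin_num_measure//.
    transitivity (\int[P]_w (\1_(Y i0 @^-1` A) w)%:E)%E => //.
    by rewrite integral_indic// setIT.
  + move=> j kj; rewrite /g'; case: eqP => [_|/eqP ji]; first by exists A.
    by apply: gind; rewrite ltn_neqAle kj andbT eq_sym.
Qed.

(** * Means of real random variables *)

(** The integral is the difference of those of the positive and negative
parts, and such a difference is finite only if both terms are. *)
Lemma integrable_fin_num_integral (d : measure_display) (T : measurableType d)
  (R : realType) (mu : {measure set T -> \bar R}) (f : T -> R) :
  measurable_fun [set: T] f ->
  (\int[mu]_w (f w)%:E)%E \is a fin_num ->
  mu.-integrable [set: T] (EFin \o f).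
Proof.
move=> mf; have mEf : measurable_fun [set: T] (EFin \o f).
  exact/measurable_EFinP.
rewrite integralE fin_numB => /andP[fp fn]; apply/integrableP; split => //.
rewrite (eq_integral ((EFin \o f)^\+ \+ (EFin \o f)^\-)%E); last first.
  by move=> w _; rewrite -[LHS]/((abse \o (EFin \o f)) w) fune_abse.
rewrite ge0_integralD//; first by rewrite ltey_eq fin_numD fp fn.
- exact: measurable_funepos.
- exact: measurable_funeneg.
Qed.

(** Integrability and the value of the integral travel together, so that
finite sums stay within the real numbers. *)
Definition has_mean (d : measure_display) (T : measurableType d) (R : realType)
    (P : probability T R) (X : T -> R) (e : R) : Prop :=
  P.-integrable [set: T] (EFin \o X) /\ (\int[P]_w (X w)%:E = e%:E)%E.

Section has_mean_linear.
Context (d : measure_display) (T : measurableType d) (R : realType).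
Variable P : probability T R.

Lemma has_mean_cst (c : R) : has_mean P (fun=> c) c.
Proof.
split; first exact: finite_measure_integrable_cst.
by rewrite /= integral_cst//= probability_setT mule1.
Qed.

Lemma has_meanD (X Y : T -> R) (e f : R) :
  has_mean P X e -> has_mean P Y f -> has_mean P (fun w => X w + Y w) (e + f).
Proof.
move=> [iX EX] [iY EY]; split; first exact: (integrableD measurableT iX iY).
have := integralD_EFin measurableT iX iY.
by rewrite /= EX EY.
Qed.

Lemma has_meanZ (X : T -> R) (e c : R) :
  has_mean P X e -> has_mean P (fun w => c * X w) (c * e).
Proof.
move=> [iX EX]; split; first exact: (integrableZl measurableT c iX).
by have := integralZl measurableT iX c; rewrite /= EX.
Qed.

Lemma has_mean_sum (I : Type) (r : seq I) (X : I -> T -> R) (e : I -> R) :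
  (forall i, has_mean P (X i) (e i)) ->
  has_mean P (fun w => \sum_(i <- r) X i w) (\sum_(i <- r) e i).
Proof.
move=> Xe; elim: r => [|i r IH].
  rewrite big_nil (_ : (fun w => _) = fun=> 0); first exact: has_mean_cst.
  by apply/funext => w; rewrite big_nil.
rewrite big_cons (_ : (fun w => _) = fun w => X i w + \sum_(j <- r) X j w).
  exact: has_meanD.
by apply/funext => w; rewrite big_cons.
Qed.

Lemma has_mean_le (X Y : T -> R) (e f : R) :
  has_mean P X e -> has_mean P Y f -> (forall w, X w <= Y w) -> e <= f.
Proof.
move=> [iX EX] [iY EY] XY; rewrite -lee_fin -EX -EY.
by apply: le_integral => // w _; rewrite lee_fin.
Qed.

(** Taking expectations in [1 + t X <= e^(t X)] gives [1 + t E(X) <= M t]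
with equality at [t = 0], so [M t - t E(X)] is minimal at [0], where its
derivative is [m - E(X)]. *)
Lemma mean_of_mgf (X : T -> R) (M : R -> R) (m : R) :
  measurable_fun [set: T] X ->
  (forall t, \int[P]_w (expR (t * X w))%:E = (M t)%:E)%E ->
  (forall t : R, derivable M t 1) -> is_derive (0 : R) 1 M m ->
  has_mean P X m.
Proof.
move=> mX ME dM M0.
have mexp t : measurable_fun [set: T] (fun w => expR (t * X w)).
  by apply: measurableT_comp => //; exact: measurable_funM.
have expM t : has_mean P (fun w => expR (t * X w)) (M t).
  by split=> //; apply: integrable_fin_num_integral => //; rewrite ME.
(* [|X| <= e^X + e^(-X)]. *)
have iX : P.-integrable [set: T] (EFin \o X).
  have [isum _] := has_meanD (expM 1) (expM (-1)).
  apply: (le_integrable measurableT _ _ isum); first exact/measurable_EFinP.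
  move=> w _ /=; rewrite lee_fin mul1r mulN1r.
  rewrite [leRHS]ger0_norm ?addr_ge0 ?expR_ge0//.
  have := expR_ge1Dx (X w); have := expR_ge1Dx (- X w).
  have := expR_gt0 (X w); have := expR_gt0 (- X w).
  by rewrite ler_norml; lra.
have [e EX] : exists e : R, (\int[P]_w (X w)%:E = e%:E)%E.
  exists (fine (\int[P]_w (X w)%:E)%E); rewrite fineK//.
  exact: integrable_fin_num.
have Xe : has_mean P X e by [].
suff me : m - e = 0 by rewrite (subr0_eq me).
have Mge t : 1 + t * e <= M t.
  apply: (has_mean_le (has_meanD (has_mean_cst 1) (has_meanZ t Xe)) (expM t)).
  by move=> w; exact: expR_ge1Dx.
have M01 : M 0 = 1.
  apply/EFin_inj; rewrite -ME; under eq_integral do rewrite mul0r expR0.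
  by rewrite /= integral_cst//= probability_setT mule1.
apply: (@derive_at_global_min _ (fun t : R => M t - t * e) 0) => [t||t].
- by apply: derivableB.
- by apply: is_derive_eq; rewrite /GRing.scale /=; ring.
- by rewrite M01 mul0r subr0; have := Mge t; lra.
Qed.

End has_mean_linear.

(** * The cumulant function *)

Section curvature.
Context (R : realType) (b : R -> R) (C : R).
Hypothesis bconv : strictly_convex b.
Hypothesis bder : three_times_derivable b.
Hypothesis C1 : 1 <= C.
Hypothesis bC : forall z : R,
  (ereal_sup [set (derive1n 2 b (z + y)%R)%:E | y in [set y : R | `|y| <= 2^-1]%R]
    <= (C * derive1n 2 b z)%:E)%E.

Lemma is_derive_cumulant (z : R) : is_derive z 1 b (derive1 b z).
Proof. by rewrite derive1E; apply: derivableP; exact: (@bder 0 isT z). Qed.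

Lemma is_derive2_cumulant (z : R) :
  is_derive z 1 (derive1 b) (derive1n 2 b z).
Proof.
rewrite /derive1n /= [derive1 (derive1 b) z]derive1E.
by apply: derivableP; exact: (@bder 1 isT z).
Qed.

Lemma cumulant_quadratic_le (z s : R) : `|s| <= 2^-1 ->
  b (z + s) - b z - s * derive1 b z <= C * derive1n 2 b z * s ^+ 2 / 2.
Proof.
apply: taylor2_le => [y|y|y y2]; first exact: is_derive_cumulant.
  exact: is_derive2_cumulant.
rewrite -lee_fin; apply: le_trans (bC z).
by apply: ereal_sup_ubound; exists y.
Qed.

(** If [b''(z) <= 0], the deviation bound makes the second derivative
nonpositive on the whole ball of radius [1/2] around [z], so [b] is nowhere
above its tangent at [z] there; this contradicts strict convexity between
[z - 1/2] and [z + 1/2]. *)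
Lemma derive2_cumulant_gt0 (z : R) : 0 < derive1n 2 b z.
Proof.
rewrite ltNge; apply/negP => b2.
have C0 : C * derive1n 2 b z <= 0 by rewrite mulr_ge0_le0// (le_trans _ C1).
have h (s : R) : `|s| <= 2^-1 -> b (z + s) - b z - s * derive1 b z <= 0.
  move=> /cumulant_quadratic_le /le_trans; apply.
  by rewrite -mulrA mulr_le0_ge0// divr_ge0// sqr_ge0.
have := h 2^-1; rewrite ger0_norm ?invr_ge0// => /(_ (lexx _)) hp.
have := h (- 2^-1); rewrite normrN ger0_norm ?invr_ge0// => /(_ (lexx _)) hm.
have := @bconv (z + 2^-1) (z - 2^-1) 2^-1.
have -> : 2^-1 * (z + 2^-1) + (1 - 2^-1) * (z - 2^-1) = z by field.
have neq : z + 2^-1 != z - 2^-1 by rewrite gt_eqF//; lra.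
have h01 : 0 < (2^-1 : R) < 1 by lra.
by move=> /(_ neq h01); lra.
Qed.

End curvature.

(** First-order condition at [t = 0] for the objective
[sum_i (y_i m_i - b(y_i))] along the line [y_i = eta_i + t c_i]. *)
Lemma stationary_sum (R : realType) (b : R -> R) n (m c eta : 'I_n -> R) :
  (forall z : R, is_derive z 1 b (derive1 b z)) ->
  (forall t : R, \sum_i (t * c i * m i - (b (eta i + t * c i) - b (eta i))) <= 0) ->
  \sum_i (m i - derive1 b (eta i)) * c i = 0.
Proof.
move=> bder le0.
pose h i (t : R) : R := b (eta i + t * c i) - b (eta i) - t * c i * m i.
have dh i (t : R) :
    is_derive t 1 (h i) (derive1 b (eta i + t * c i) * c i - c i * m i).
  have lin : is_derive t 1 (fun t : R => eta i + t * c i) (c i).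
    by apply: is_derive_eq; rewrite /GRing.scale /=; ring.
  have bl := @is_derive1_comp _ b (fun t : R => eta i + t * c i) t _ _
    (bder (eta i + t * c i)) lin.
  have -> : h i = (b \o (fun t : R => eta i + t * c i)) -
      (fun t => b (eta i) + t * c i * m i).
    by apply/funext => s; rewrite /h /= opprD addrA.
  by apply: is_derive_eq; rewrite /GRing.scale /=; ring.
have dH (t : R) := is_derive_sum (dh ^~ t).
have H0 t : (\sum_i h i) 0 <= (\sum_i h i) t.
  rewrite !fct_sumE big1 => [|i _]; last by rewrite /h !mul0r addr0 !subrr.
  rewrite -oppr_le0 -sumrN; apply: le_trans (le0 t).
  by apply: ler_sum => i _; rewrite /h opprB.
have E0 := derive_at_global_min
  (fun t : R => @ex_derive _ _ _ _ _ _ _ (dH t)) (dH 0) H0.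
rewrite -[RHS]oppr0 -[in RHS]E0 -sumrN.
by apply: eq_bigr => i _; rewrite mul0r addr0; ring.
Qed.

(** * Chernoff's bound for weighted sums *)

(** By independence the moment generating function of the sum factorizes, so
its logarithm at [r] adds up the cumulant generating functions [K i] at
[r * a i]; the rest is Chernoff's bound. *)
Lemma independent_chernoff (d : measure_display) (T : measurableType d)
  (R : realType) (P : probability T R) n (Y : 'I_n -> {RV P >-> R})
  (K : 'I_n -> R -> R) (a mu : 'I_n -> R) (r s : R) :
  mutually_independent Y ->
  (forall i t, mmt_gen_fun P (Y i) t = (expR (K i t))%:E) ->
  0 < r ->
  (P [set w | (\sum_i a i * (Y i w - mu i) > s)%R] <=
   (expR (\sum_i (K i (r * a i) - r * a i * mu i) - r * s))%:E)%E.
Proof.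
move=> Yind mgf r0.
pose Zf w := \sum_i a i * (Y i w - mu i).
have mZ : measurable_fun [set: T] Zf.
  apply: measurable_sum => i; apply: measurable_funM => //.
  exact: measurable_funB.
pose Z : {RV P >-> R} := HB.pack Zf (isMeasurableFun.Build _ _ _ _ Zf mZ).
pose g i (y : R) := expR (r * a i * (y - mu i)).
have mg i : measurable_fun [set: R] (g i).
  apply: measurableT_comp => //; apply: measurable_funM => //.
  exact: measurable_funB.
have gK i : (\int[P]_w (g i (Y i w))%:E =
    (expR (K i (r * a i) - r * a i * mu i))%:E)%E.
  rewrite expRD EFinM -mgf /mmt_gen_fun unlock muleC.
  rewrite -ge0_integralZl//.
  - apply: eq_integral => w _; rewrite -EFinM -expRD /g /=.
    by congr (expR _)%:E; ring.
  - apply/measurable_EFinP.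
    have mrY : measurable_fun [set: T] (fun w => Y i w * (r * a i)).
      exact: measurable_funM.
    exact: (measurableT_comp (@measurable_expR R) mrY).
  - by move=> w _; rewrite lee_fin expR_ge0.
have MZ : mmt_gen_fun P Z r =
    (expR (\sum_i (K i (r * a i) - r * a i * mu i)))%:E.
  rewrite expR_sum -(independent_integral_prod Yind mg _ gK); last first.
    by move=> i y; exact: expR_ge0.
  rewrite /mmt_gen_fun unlock; apply: eq_integral => w _.
  rewrite -expR_sum /= /Zf mulr_suml; congr (expR _)%:E.
  by apply: eq_bigr => i _; ring.
have := chernoff Z s r0; rewrite MZ -EFinM -expRD; apply: le_trans.
have mpre (A : set R) : measurable A -> measurable (Zf @^-1` A).
  by move=> mA; rewrite -[X in measurable X]setTI; apply (mZ measurableT).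
rewrite (_ : [set w | _] = Zf @^-1` `]s, +oo[); last first.
  by apply/seteqP; split=> w; rewrite /= in_itv /= andbT.
rewrite (_ : [set w | s <= _] = Zf @^-1` `[s, +oo[); last first.
  by apply/seteqP; split=> w; rewrite /= in_itv /= andbT.
by apply: le_measure; rewrite ?inE; [exact: mpre|exact: mpre|];
  apply: preimage_subset; apply: subset_itvr; rewrite bnd_simp.
Qed.

(** * The normalized score *)

(** A positive semidefinite square root is symmetric, and where none exists
[sqrtmx] takes the default value [0], which is symmetric too. *)
Lemma invsqrtmx_sym (R : realType) m (A : 'M[R]_m) :
  (invsqrtmx A)^T = invsqrtmx A.
Proof.
rewrite /invsqrtmx trmx_inv; congr invmx; rewrite /sqrtmx.
by case: xgetP => [B _ [[]]//|_]; rewrite trmx0.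
Qed.

Lemma score_variance_form (R : realType) (b : R -> R) n p
  (x : 'I_n -> 'cV[R]_p) (S : {set 'I_p}) (theta0 : 'cV[R]_p)
  (v : 'cV[R]_#|S|) :
  dotv v (score_variance b x S theta0 *m v) =
  \sum_i derive1n 2 b (dotv (x i) theta0) * dotv (subvec S (x i)) v ^+ 2.
Proof.
rewrite /score_variance mulmx_suml dotv_sumr; apply: eq_bigr => i _.
rewrite -scalemxAl dotvZr; congr (_ * _).
rewrite -mulmxA [_^T *m v]mx11_scalar -/(dotv _ v) mul_mx_scalar dotvZr.
by rewrite (dotvC v) expr2.
Qed.

Lemma score_variance_sym (R : realType) (b : R -> R) n p
  (x : 'I_n -> 'cV[R]_p) (S : {set 'I_p}) (theta0 : 'cV[R]_p) :
  (score_variance b x S theta0)^T = score_variance b x S theta0.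
Proof.
rewrite /score_variance linear_sum; apply: eq_bigr => i _.
by rewrite linearZ /= trmx_mul trmxK.
Qed.

Lemma Delta_mis_ge (R : realType) (b : R -> R) n p
  (x : 'I_n -> 'cV[R]_p) (S : {set 'I_p}) (theta0 : 'cV[R]_p)
  (thetaS u : 'cV[R]_#|S|) : norm2 u = 1 ->
  \sum_i derive1n 2 b (dotv (x i) theta0) *
    dotv (subvec S (x i)) (invsqrtmx (fisher b x thetaS) *m u) ^+ 2
  <= Delta_mis b x theta0 thetaS.
Proof.
move=> u1; set A := invsqrtmx _; rewrite -score_variance_form.
rewrite dotv_mulmxl invsqrtmx_sym -/A !mulmxA; apply: rayleigh_le_lambda_max => //.
by rewrite !trmx_mul invsqrtmx_sym score_variance_sym mulmxA.
Qed.

Lemma score_weight_le_zeta (R : realType) (b : R -> R) n p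
  (x : 'I_n -> 'cV[R]_p) (S : {set 'I_p}) (thetaS u : 'cV[R]_#|S|) (i : 'I_n) :
  norm2 u = 1 ->
  `|dotv (subvec S (x i)) (invsqrtmx (fisher b x thetaS) *m u)| <=
  zeta b x thetaS.
Proof.
move=> u1; rewrite dotvC dotv_mulmxl invsqrtmx_sym.
apply: le_trans (dotv_cauchy_schwarz _ u1) _.
by rewrite /zeta; exact: (le_bigmax _ _ i).
Qed.

Lemma dotv_normalized_score (R : realType) (b : R -> R) n p
  (x : 'I_n -> 'cV[R]_p) (S : {set 'I_p}) (y : 'I_n -> R)
  (thetaS u : 'cV[R]_#|S|) :
  dotv u (normalized_score b x y thetaS) =
  \sum_i dotv (subvec S (x i)) (invsqrtmx (fisher b x thetaS) *m u) *
    (y i - derive1 b (dotv (subvec S (x i)) thetaS)).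
Proof.
rewrite /normalized_score -[X in X *m _]invsqrtmx_sym -dotv_mulmxl dotv_sumr.
by apply: eq_bigr => i _; rewrite dotvZr (dotvC (_ *m u)) mulrC.
Qed.

(** Finiteness of the maximum makes the log-likelihood at [thetaS], hence its
term in [k], integrable; the increment from [thetaS] to [thetaS + t *: v] does
not involve [k] and has an explicit mean, which is nonpositive for all [t]. *)
Lemma score_equation (R : realType) (b k : R -> R) n p
  (x : 'I_n -> 'cV[R]_p) (S : {set 'I_p}) (d : measure_display)
  (T : measurableType d) (P : probability T R) (Y : 'I_n -> {RV P >-> R})
  (m : 'I_n -> R) (thetaS : 'cV[R]_#|S|) (v : 'cV[R]_#|S|) :
  (forall z : R, is_derive z 1 b (derive1 b z)) ->
  measurable_fun [set: R] k ->
  (forall i, has_mean P (Y i) (m i)) ->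
  is_argmax
    (fun t : 'cV[R]_#|S| => 'E_P[fun w => loglik b k x (Y ^~ w) t])%E thetaS ->
  \sum_i (m i - derive1 b (dotv (subvec S (x i)) thetaS)) *
    dotv (subvec S (x i)) v = 0.
Proof.
move=> bder mk Ym [Lfin Lmax].
apply: stationary_sum => // t.
pose L (th : 'cV[R]_#|S|) w := loglik b k x (Y ^~ w) th.
have mL : measurable_fun [set: T] (L thetaS).
  apply: measurable_sum => i; apply: measurable_funD.
    by apply: measurable_funB => //; exact: measurable_funM.
  exact: measurableT_comp.
move: Lfin Lmax; rewrite unlock => Lfin Lmax.
have EL : has_mean P (L thetaS) (fine (\int[P]_w (L thetaS w)%:E)%E).
  by split; [exact: integrable_fin_num_integral|rewrite fineK].
pose z i := dotv (subvec S (x i)) thetaS.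
pose c i := dotv (subvec S (x i)) v.
have incr : has_mean P
    (fun w => \sum_i (t * c i * Y i w + - (b (z i + t * c i) - b (z i))))
    (\sum_i (t * c i * m i + - (b (z i + t * c i) - b (z i)))).
  apply: has_mean_sum => i; apply: has_meanD; last exact: has_mean_cst.
  exact: has_meanZ.
have [_ E'] := has_meanD EL incr.
have := Lmax (thetaS + t *: v).
rewrite -[X in (_ <= X)%E]fineK//.
rewrite (eq_integral (fun w => (L thetaS w +
    \sum_i (t * c i * Y i w + - (b (z i + t * c i) - b (z i))))%:E)).
  by rewrite E' lee_fin gerDl.
move=> w _; congr (_%:E); rewrite /L /loglik -big_split /=.
by apply: eq_bigr => i _; rewrite dotvDr dotvZr -/(z i) -/(c i); ring.
Qed.

(** * The tail bound *)

Theorem lemmaB1 (R : realType) (n p : nat) (x : 'I_n -> 'cV[R]_p)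
  (b k : R -> R) (nu : {sigma_finite_measure set (measurableTypeR R) -> \bar R})
  (hb_convex : strictly_convex b)
  (hb_deriv : three_times_derivable b)
  (hmodel : glm_model b k nu p)
  (Cdev : R) (hCdev1 : 1 <= Cdev)
  (hCdev : forall z : R,
     (ereal_sup [set (derive1n 2 b (z + y)%R)%:E | y in [set y : R | `|y| <= 2^-1]%R]
        <= (Cdev * derive1n 2 b z)%:E)%E)
  (d : measure_display) (Omega : measurableType d) (P : probability Omega R)
  (Y : 'I_n -> {RV P >-> R}) (theta0 : 'cV[R]_p) (htheta0 : theta0 != 0)
  (hindep : mutually_independent Y)
  (hlaw : forall i, has_density nu (Y i) (glm_density b k theta0 (x i)))
  (hmgf : forall (i : 'I_n) (t : R),
     mmt_gen_fun P (Y i) t =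
       (expR (b (dotv (x i) theta0 + t) - b (dotv (x i) theta0)))%:E)
  (S : {set 'I_p}) (thetaS : 'cV[R]_#|S|)
  (hthetaS : is_argmax
     (fun t : 'cV[R]_#|S| => 'E_P[fun w => loglik b k x (Y ^~ w) t])%E thetaS)
  (omega : R) (homega : 0 < omega)
  (hF : fisher b x thetaS \in unitmx)
  (hsmall : Num.sqrt 2 * omega * zeta b x thetaS
              / Num.sqrt (Cdev * Delta_mis b x theta0 thetaS) <= 2^-1)
  (u : 'cV[R]_#|S|) (hu : norm2 u = 1) :
  (P [set w | (dotv u (normalized_score b x (Y ^~ w) thetaS) >
               Num.sqrt (2 * Cdev * Delta_mis b x theta0 thetaS * omega ^+ 2))%R]
     <= (expR (- omega ^+ 2))%:E)%E.
Proof.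
have bder := is_derive_cumulant hb_deriv.
pose eta i := dotv (x i) theta0.
pose Delta := Delta_mis b x theta0 thetaS.
pose v := invsqrtmx (fisher b x thetaS) *m u.
pose a i := dotv (subvec S (x i)) v.
have dM i (t : R) : is_derive t 1 (fun t => expR (b (eta i + t) - b (eta i)))
    (expR (b (eta i + t) - b (eta i)) * derive1 b (eta i + t)).
  have dshift : is_derive t 1 (fun t : R => eta i + t) 1.
    by apply: is_derive_eq; rewrite add0r mulr1.
  have db : is_derive t 1 (fun t : R => b (eta i + t) - b (eta i))
      (derive1 b (eta i + t)).
    have := @is_derive1_comp _ b (fun t : R => eta i + t) t _ _ (bder _) dshift.
    move=> db; rewrite (_ : (fun t => _) =
      (b \o (fun t : R => eta i + t)) - (fun=> b (eta i)))//.
    by apply: is_derive_eq; rewrite mulr1 subr0.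
  exact: (@is_derive1_comp _ expR (fun t : R => b (eta i + t) - b (eta i))
    t _ _ (is_derive_expR _) db).
have Ymean i : has_mean P (Y i) (derive1 b (eta i)).
  apply: (@mean_of_mgf _ _ _ _ _
    (fun t => expR (b (eta i + t) - b (eta i)))) => //.
  - move=> t; rewrite -hmgf /mmt_gen_fun unlock; apply: eq_integral => w _.
    by rewrite /= mulrC.
  - apply: (is_derive_eq (dM i 0)).
    by rewrite addr0 subrr expR0 mul1r.
have weightE : \sum_i a i ^+ 2 * derive1n 2 b (eta i) <= Delta.
  apply: le_trans (Delta_mis_ge b x theta0 thetaS hu).
  by apply: ler_sum => i _; rewrite mulrC.
have scoreE w : dotv u (normalized_score b x (Y ^~ w) thetaS) =
    \sum_i a i * (Y i w - derive1 b (eta i)).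
  rewrite dotv_normalized_score -/v.
  apply/eqP; rewrite -subr_eq0 -sumrB.
  apply/eqP; rewrite -[RHS](score_equation v bder hmodel.1 Ymean hthetaS).
  by apply: eq_bigr => i _; rewrite -/(a i); ring.
under eq_set do rewrite scoreE.
have b2 i : 0 < derive1n 2 b (eta i).
  exact: (derive2_cumulant_gt0 hb_convex hb_deriv hCdev1 hCdev).
have Cdev0 : 0 < Cdev by exact: lt_le_trans hCdev1.
have Delta0 : 0 <= Delta.
  apply: le_trans weightE; apply: sumr_ge0 => i _.
  by rewrite mulr_ge0 ?sqr_ge0// ltW.
(* If [Delta = 0], positivity of [b''] in [weightE] makes every weight vanish. *)
move: Delta0; rewrite le_eqVlt => /predU1P[Delta0|Delta0].
  have a0 i : a i = 0.
    apply/eqP; rewrite -sqrf_eq0 eq_le sqr_ge0 andbT -(pmulr_lle0 _ (b2 i)).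
    rewrite [leRHS]Delta0; apply: le_trans weightE.
    rewrite (bigD1 i)// lerDl; apply: sumr_ge0 => j _.
    by rewrite mulr_ge0 ?sqr_ge0// ltW.
  rewrite (_ : [set w | _] = set0) ?measure0 ?lee_fin ?expR_ge0//.
  apply/seteqP; split => w //=; rewrite big1 ?ltNge ?sqrtr_ge0// => i _.
  by rewrite a0 mul0r.
have CD0 : 0 < Cdev * Delta by exact: mulr_gt0.
(* The minimizer of [Cdev * Delta * r ^+ 2 / 2 - r * s] at the threshold [s]. *)
pose r := Num.sqrt 2 * omega / Num.sqrt (Cdev * Delta).
have r0 : 0 < r by rewrite divr_gt0 ?mulr_gt0 ?sqrtr_gt0.
have ra i : `|r * a i| <= 2^-1.
  apply: le_trans hsmall; rewrite normrM gtr0_norm// /r mulrAC.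
  rewrite ler_pM2r ?invr_gt0 ?sqrtr_gt0// ler_pM2l ?mulr_gt0 ?sqrtr_gt0//.
  exact: score_weight_le_zeta.
apply: le_trans (independent_chernoff a (fun i => derive1 b (eta i)) _
  hindep hmgf r0) _.
rewrite lee_fin ler_expR.
set q := Num.sqrt (Cdev * Delta) in r r0 ra *.
have q0 : 0 < q by rewrite sqrtr_gt0.
have q2 : q ^+ 2 = Cdev * Delta by rewrite sqr_sqrtr// ltW.
have s2 : Num.sqrt 2 ^+ 2 = 2 :> R by rewrite sqr_sqrtr.
have -> : Num.sqrt (2 * Cdev * Delta * omega ^+ 2) = Num.sqrt 2 * q * omega.
  rewrite (_ : 2 * Cdev * Delta * _ = (Num.sqrt 2 * q * omega) ^+ 2).
    by rewrite sqrtr_sqr gtr0_norm// !mulr_gt0// sqrtr_gt0.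
  by rewrite !exprMn s2 q2; ring.
have -> : r * (Num.sqrt 2 * q * omega) = 2 * omega ^+ 2.
  by rewrite -[in RHS]s2 /r; field; rewrite gt_eqF.
have r2 : Cdev * Delta * r ^+ 2 / 2 = omega ^+ 2.
  rewrite /r -q2 !exprMn s2 exprVn.
  by field; rewrite gt_eqF.
suff : \sum_i (b (eta i + r * a i) - b (eta i) - r * a i * derive1 b (eta i)) <=
    omega ^+ 2 by lra.
rewrite -r2.
apply: (@le_trans _ _ (Cdev * (\sum_i a i ^+ 2 * derive1n 2 b (eta i)) * r ^+ 2 / 2)).
  rewrite mulr_sumr !mulr_suml; apply: ler_sum => i _.
  apply: le_trans (cumulant_quadratic_le hb_deriv hCdev (eta i) (ra i)) _.
  by rewrite le_eqVlt; apply/orP; left; apply/eqP; ring.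
by rewrite ler_pM2r ?invr_gt0// ler_pM2r ?exprn_gt0// ler_pM2l.
Qed.
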